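(* $\mathbb{N}$ is a set: for all $x,y:\mathbb{N}$ and all computational paths $p,q:x=y$, we have $p=q$.
   Context: Computational paths: $a=_s b:A$ denotes a computational path, i.e. a finite composition of rewrites, each an application of an axiom or inference rule of the $\lambda\beta\eta$-equality theory of type theory. Equality between paths means there is a path between them. $\mathbb{N}$ is generated by $0$ and $succ$. Its path space is generated from the reflexive path $0=_{\rho}0$ by applications of the inference rules of $\lambda\beta\eta$-equality. A type is a set if any two paths between the same two points are equal. *)

(* Defs.v *)
From Stdlib Require Import List Relations.
Import ListNotations.

Set Implicit Arguments.
Unset Strict Implicit.

(** Simply typed lambda-terms over the type N generated by [0] and [succ].
    Terms are intrinsically typed, with de Bruijn variables, so that
    alpha-conversion is the identity. *)

Inductive ty : Type :=
| Nat : ty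
| Arr : ty -> ty -> ty.

Definition ctx := list ty.

Inductive var : ctx -> ty -> Type :=
| vz G A : var (A :: G) A
| vs G A B : var G A -> var (B :: G) A.

Inductive tm : ctx -> ty -> Type :=
| tvar G A : var G A -> tm G A
| zero G : tm G Nat
| succ G : tm G (Arr Nat Nat)
| app G A B : tm G (Arr A B) -> tm G A -> tm G B
| lam G A B : tm (A :: G) B -> tm G (Arr A B).

Arguments vz {G A}.
Arguments vs {G A} B _.
Arguments zero {G}.
Arguments succ {G}.

Definition ren (G D : ctx) := forall A, var G A -> var D A.

Definition ren_up G D (r : ren G D) B : ren (B :: G) (B :: D) :=
  fun A v =>
    match v in var G' A' return
      match G' with
      | [] => unit
      | B' :: G0 => ren G0 D -> var (B' :: D) A'
      end
    with
    | vz => fun _ => vz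
    | vs B' w => fun r => vs B' (r _ w)
    end r.

Fixpoint rename G A (t : tm G A) : forall D, ren G D -> tm D A :=
  match t in tm G' A' return forall D, ren G' D -> tm D A' with
  | tvar v => fun D r => tvar (r _ v)
  | zero => fun D r => zero
  | succ => fun D r => succ
  | app f a => fun D r => app (rename f r) (rename a r)
  | lam b => fun D r => lam (rename b (ren_up r (B := _)))
  end.

Definition shift G A B (t : tm G A) : tm (B :: G) A :=
  rename t (fun _ v => vs B v).

Definition sub (G D : ctx) := forall A, var G A -> tm D A.

Definition sub_up G D (s : sub G D) B : sub (B :: G) (B :: D) :=
  fun A v =>
    match v in var G' A' return
      match G' with
      | [] => unit
      | B' :: G0 => sub G0 D -> tm (B' :: D) A'
      end
    with
    | vz => fun _ => tvar vz
    | vs B' w => fun s => shift B' (s _ w)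
    end s.

Fixpoint subst G A (t : tm G A) : forall D, sub G D -> tm D A :=
  match t in tm G' A' return forall D, sub G' D -> tm D A' with
  | tvar v => fun D s => s _ v
  | zero => fun D s => zero
  | succ => fun D s => succ
  | app f a => fun D s => app (subst f s) (subst a s)
  | lam b => fun D s => lam (subst b (sub_up s (B := _)))
  end.

Definition sub_one G B (n : tm G B) : sub (B :: G) G :=
  fun A v =>
    match v in var G' A' return
      match G' with
      | [] => unit
      | B' :: G0 => tm G0 B' -> tm G0 A'
      end
    with
    | vz => fun n => n
    | vs _ w => fun _ => tvar w
    end n.

Definition subst1 G A B (m : tm (B :: G) A) (n : tm G B) : tm G A :=
  subst m (sub_one n).

(** Computational paths: derivations in the theory of lambda-beta-eta-equality,
    with axioms [rho], [beta], [eta] and inference rules [sigma] (symmetry),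
    [tau] (transitivity), [mu] and [nu] (congruence in the argument and in the
    function of an application) and [xi] (congruence under abstraction). *)

Inductive cpath : forall G A, tm G A -> tm G A -> Type :=
| rho G A (t : tm G A) : cpath t t
| beta G A B (m : tm (A :: G) B) (n : tm G A) :
    cpath (app (lam m) n) (subst1 m n)
| eta G A B (m : tm G (Arr A B)) :
    cpath (lam (app (shift A m) (tvar vz))) m
| sigma G A (t u : tm G A) : cpath t u -> cpath u t
| tau G A (t u v : tm G A) : cpath t u -> cpath u v -> cpath t v
| mu G A B (m : tm G (Arr A B)) (n n' : tm G A) :
    cpath n n' -> cpath (app m n) (app m n')
| nu G A B (m m' : tm G (Arr A B)) (n : tm G A) :
    cpath m m' -> cpath (app m n) (app m' n)
| xi G A B (m m' : tm (A :: G) B) :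
    cpath m m' -> cpath (lam m) (lam m').

(** Contexts [C[ ]] with one hole of type [A] under variables [G], acting both
    on terms and, through [mu], [nu] and [xi], on paths. *)

Inductive hctx (G : ctx) (A : ty) : ctx -> ty -> Type :=
| hole : hctx G A G A
| hmu D B C : tm D (Arr B C) -> hctx G A D B -> hctx G A D C
| hnu D B C : hctx G A D (Arr B C) -> tm D B -> hctx G A D C
| hxi D B C : hctx G A (B :: D) C -> hctx G A D (Arr B C).

Arguments hole {G A}.

Fixpoint plug_tm G A D B (C : hctx G A D B) (t : tm G A) : tm D B :=
  match C in hctx _ _ D' B' return tm D' B' with
  | hole => t
  | hmu m C' => app m (plug_tm C' t)
  | hnu C' n => app (plug_tm C' t) n
  | hxi C' => lam (plug_tm C' t)
  end.

Fixpoint plug G A D B (C : hctx G A D B) (t u : tm G A) (p : cpath t u) :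
    cpath (plug_tm C t) (plug_tm C u) :=
  match C in hctx _ _ D' B' return cpath (plug_tm C t) (plug_tm C u) with
  | hole => p
  | hmu m C' => mu m (plug C' p)
  | hnu C' n => nu n (plug C' p)
  | hxi C' => xi (plug C' p)
  end.

(** One rewriting step between parallel paths: the rules of the system
    LND_EQ-TRS for the path constructors above, under their usual names.
    The rules [nu (xi r) |> r] and [xi (nu r) |> r] of that system relate paths
    whose end points agree only up to beta and eta; they are left out here,
    which makes the equality of paths finer. *)

Inductive rw : forall G A (t u : tm G A), cpath t u -> cpath t u -> Prop :=
| rw_sr G A (t : tm G A) : rw (sigma (rho t)) (rho t)
| rw_ss G A (t u : tm G A) (r : cpath t u) : rw (sigma (sigma r)) r
| rw_tr G A D B (C : hctx G A D B) (t u : tm G A) (r : cpath t u) :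
    rw (tau (plug C r) (plug C (sigma r))) (plug C (rho t))
| rw_tsr G A D B (C : hctx G A D B) (t u : tm G A) (r : cpath t u) :
    rw (tau (plug C (sigma r)) (plug C r)) (plug C (rho u))
| rw_trr G A D B (C : hctx G A D B) (t u : tm G A) (r : cpath t u) :
    rw (tau (plug C r) (plug C (rho u))) (plug C r)
| rw_tlr G A D B (C : hctx G A D B) (t u : tm G A) (r : cpath t u) :
    rw (tau (plug C (rho t)) (plug C r)) (plug C r)
| rw_stss G A (t u v : tm G A) (r : cpath t u) (s : cpath u v) :
    rw (sigma (tau r s)) (tau (sigma s) (sigma r))
| rw_sm G A B (m : tm G (Arr A B)) (n n' : tm G A) (r : cpath n n') :
    rw (sigma (mu m r)) (mu m (sigma r))
| rw_sn G A B (m m' : tm G (Arr A B)) (n : tm G A) (r : cpath m m') :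
    rw (sigma (nu n r)) (nu n (sigma r))
| rw_sx G A B (m m' : tm (A :: G) B) (r : cpath m m') :
    rw (sigma (xi r)) (xi (sigma r))
| rw_tt G A (t u v w : tm G A)
    (r : cpath t u) (s : cpath u v) (s' : cpath v w) :
    rw (tau (tau r s) s') (tau r (tau s s'))
| rw_tts G A D B (C : hctx G A D B) (t u : tm G A) (r : cpath t u)
    (w : tm D B) (s : cpath (plug_tm C t) w) :
    rw (tau (plug C r) (tau (plug C (sigma r)) s)) s
| rw_tst G A D B (C : hctx G A D B) (t u : tm G A) (r : cpath t u)
    (w : tm D B) (s : cpath (plug_tm C u) w) :
    rw (tau (plug C (sigma r)) (tau (plug C r) s)) s
| rw_in_sigma G A (t u : tm G A) (r r' : cpath t u) :
    rw r r' -> rw (sigma r) (sigma r')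
| rw_in_tau_l G A (t u v : tm G A) (r r' : cpath t u) (s : cpath u v) :
    rw r r' -> rw (tau r s) (tau r' s)
| rw_in_tau_r G A (t u v : tm G A) (r : cpath t u) (s s' : cpath u v) :
    rw s s' -> rw (tau r s) (tau r s')
| rw_in_mu G A B (m : tm G (Arr A B)) (n n' : tm G A) (r r' : cpath n n') :
    rw r r' -> rw (mu m r) (mu m r')
| rw_in_nu G A B (m m' : tm G (Arr A B)) (n : tm G A) (r r' : cpath m m') :
    rw r r' -> rw (nu n r) (nu n r')
| rw_in_xi G A B (m m' : tm (A :: G) B) (r r' : cpath m m') :
    rw r r' -> rw (xi r) (xi r').

(** Equality of paths: a finite composition of rewriting steps, in either
    direction. *)

Definition rweq G A (t u : tm G A) : cpath t u -> cpath t u -> Prop :=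
  clos_refl_sym_trans (cpath t u) (@rw G A t u).

(** The paths obtained from reflexive paths by the inference rules of
    lambda-beta-eta-equality.  The rules [mu], [nu] and [xi] make the generation
    pass through open terms and function types even when the resulting path
    is at type N; the reflexive path is allowed at every term, not only at
    [zero], so that in particular every numeral has its own [rho]. *)

Inductive generated : forall G A (t u : tm G A), cpath t u -> Prop :=
| gen_rho G A (t : tm G A) : generated (rho t)
| gen_sigma G A (t u : tm G A) (p : cpath t u) :
    generated p -> generated (sigma p)
| gen_tau G A (t u v : tm G A) (p : cpath t u) (q : cpath u v) :
    generated p -> generated q -> generated (tau p q)
| gen_mu G A B (m : tm G (Arr A B)) (n n' : tm G A) (p : cpath n n') :
    generated p -> generated (mu m p)
| gen_nu G A B (m m' : tm G (Arr A B)) (n : tm G A) (p : cpath m m') :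
    generated p -> generated (nu n p)
| gen_xi G A B (m m' : tm (A :: G) B) (p : cpath m m') :
    generated p -> generated (xi p).

(** N has no basic paths besides the reflexive ones. *)

Definition nat_path (x y : tm [] Nat) : Type :=
  { p : cpath x y | generated p }.

Definition nat_path_eq (x y : tm [] Nat) (p q : nat_path x y) : Prop :=
  rweq (proj1_sig p) (proj1_sig q).

Definition is_set (X : Type) (P : X -> X -> Type)
    (E : forall x y, P x y -> P x y -> Prop) : Prop :=
  forall (x y : X) (p q : P x y), E x y p q.

(* Main.v *)
From Stdlib Require Import List Relations Eqdep_dec.
Require Import Defs.

(** A path generated without [beta] and [eta] joins syntactically equal terms,
    and it is equal to the reflexive path transported along that identity of
    terms.  Such identities are themselves unique, because equality of terms is
    decidable (Hedberg), so any two parallel generated paths are equal. *)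

(** * Decidable equality of terms *)

Lemma judgement_eq_dec (x y : ctx * ty) : {x = y} + {x <> y}.
Proof. repeat decide equality. Defined.

(** Bundling a variable or term with its context and type lets inhabitants of different judgements
    be compared by ordinary equality. *)
Definition any_var := {i : ctx * ty & var (fst i) (snd i)}.

Definition any_tm := {i : ctx * ty & tm (fst i) (snd i)}.

Definition pack_var G A (v : var G A) : any_var :=
  existT (fun i => var (fst i) (snd i)) (G, A) v.

Definition pack_tm G A (t : tm G A) : any_tm :=
  existT (fun i => tm (fst i) (snd i)) (G, A) t.

Arguments pack_var {G A} v.
Arguments pack_tm {G A} t.

(** Equality of judgements is decidable, so second components of dependent pairs over them can be
    compared without an axiom. *)
Lemma pack_var_inj G A (v w : var G A) : pack_var v = pack_var w -> v = w.
Proof.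
  exact (inj_pair2_eq_dec _ judgement_eq_dec
           (fun i => var (fst i) (snd i)) (G, A) v w).
Qed.

Lemma pack_tm_inj G A (t u : tm G A) : pack_tm t = pack_tm u -> t = u.
Proof.
  exact (inj_pair2_eq_dec _ judgement_eq_dec
           (fun i => tm (fst i) (snd i)) (G, A) t u).
Qed.

(** Untyped skeletons of terms. An abstraction keeps the type of its bound variable; otherwise
    identity functions at different types would erase to the same skeleton. *)
Inductive raw : Type :=
| rvar : nat -> raw
| rzero : raw
| rsucc : raw
| rapp : raw -> raw -> raw
| rlam : ty -> raw -> raw.

Lemma raw_eq_dec (r s : raw) : {r = s} + {r <> s}.
Proof. repeat decide equality. Defined.

Fixpoint var_index G A (v : var G A) : nat :=
  match v with
  | vz => 0
  | vs _ w => S (var_index _ _ w)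
  end.

Fixpoint erase G A (t : tm G A) : raw :=
  match t with
  | tvar v => rvar (var_index _ _ v)
  | zero => rzero
  | succ => rsucc
  | app f a => rapp (erase _ _ f) (erase _ _ a)
  | @lam _ A _ b => rlam A (erase _ _ b)
  end.

Arguments var_index {G A} v.
Arguments erase {G A} t.

(** A context and a position in it determine the type found there, so the types are part of the
    conclusion. *)
Lemma var_index_inj G A (v : var G A) : forall G' A' (w : var G' A'),
  G = G' -> var_index v = var_index w -> pack_var v = pack_var w.
Proof.
  induction v as [G A | G A B v IH]; intros G' A' w eG ew;
    destruct w as [G' A' | G' A' B' w]; try discriminate ew;
    injection eG; intros; subst.
  - reflexivity.
  - injection ew as ew.
    pose proof (IH _ _ w eq_refl ew) as e.
    (* The types are read off the first components of the packed equality; only once they are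
       identified can the packing be cancelled. *)
    assert (eA : A = A') by exact (f_equal (fun x => snd (projT1 x)) e).
    subst A'. apply pack_var_inj in e. subst w. reflexivity.
Qed.

(* Erasure keeps no type at an application: the type of the argument is
   recovered from the function, since the common context determines the type
   of an erased term. *)
Lemma erase_inj G A (t : tm G A) : forall G' A' (u : tm G' A'),
  G = G' -> erase t = erase u -> pack_tm t = pack_tm u.
Proof.
  induction t as [G A v | G | G | G A B f IHf a IHa | G A B b IH];
    intros G' A' u eG eu;
    destruct u as [G' A' w | G' | G' | G' A' B' f' a' | G' A' B' b'];
    try discriminate eu; subst G'; try reflexivity.
  - injection eu as ev.
    pose proof (var_index_inj _ _ v _ _ w eq_refl ev) as e.
    assert (eA : A = A') by exact (f_equal (fun x => snd (projT1 x)) e).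
    subst A'. apply pack_var_inj in e. subst w. reflexivity.
  - injection eu as ef ea.
    pose proof (IHf _ _ f' eq_refl ef) as e.
    pose proof (IHa _ _ a' eq_refl ea) as e'.
    assert (eAB : Arr A B = Arr A' B')
      by exact (f_equal (fun x => snd (projT1 x)) e).
    injection eAB as eA eB. subst A' B'.
    apply pack_tm_inj in e. apply pack_tm_inj in e'. subst f' a'. reflexivity.
  - injection eu as eA eb. subst A'.
    pose proof (IH _ _ b' eq_refl eb) as e.
    assert (eB : B = B') by exact (f_equal (fun x => snd (projT1 x)) e).
    subst B'. apply pack_tm_inj in e. subst b'. reflexivity.
Qed.

Lemma tm_eq_dec G A (t u : tm G A) : {t = u} + {t <> u}.
Proof.
  destruct (raw_eq_dec (erase t) (erase u)) as [e | ne].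
  - left. apply pack_tm_inj. now apply erase_inj.
  - right. intros e. apply ne. now rewrite e.
Qed.

Lemma tm_uip G A (t u : tm G A) (e e' : t = u) : e = e'.
Proof. apply UIP_dec. apply tm_eq_dec. Qed.

(** * Equality of paths *)

Lemma rweq_rw G A (t u : tm G A) (p q : cpath t u) : rw p q -> rweq p q.
Proof. apply rst_step. Qed.

Lemma rweq_sym G A (t u : tm G A) (p q : cpath t u) : rweq p q -> rweq q p.
Proof. apply rst_sym. Qed.

Lemma rweq_trans G A (t u : tm G A) (p q r : cpath t u) :
  rweq p q -> rweq q r -> rweq p r.
Proof. apply rst_trans. Qed.

(** Reduces compatibility of [rweq] with a path operation to single rewriting steps. *)
Lemma rweq_map G A (t u : tm G A) D B (v w : tm D B)
    (F : cpath t u -> cpath v w) :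
  (forall p q, rw p q -> rw (F p) (F q)) ->
  forall p q, rweq p q -> rweq (F p) (F q).
Proof.
  intros HF p q H. induction H as [p q H | p | p q _ IH | p q r _ IH1 _ IH2].
  - apply rweq_rw. now apply HF.
  - apply rst_refl.
  - now apply rweq_sym.
  - now apply rweq_trans with (F q).
Qed.

Lemma rweq_tau G A (t u v : tm G A) (p p' : cpath t u) (q q' : cpath u v) :
  rweq p p' -> rweq q q' -> rweq (tau p q) (tau p' q').
Proof.
  intros Hp Hq. apply rweq_trans with (tau p' q).
  - apply (rweq_map _ _ _ _ _ _ _ _ (fun x => tau x q)); [| exact Hp].
    intros; now apply rw_in_tau_l.
  - apply (rweq_map _ _ _ _ _ _ _ _ (fun x => tau p' x)); [| exact Hq].
    intros; now apply rw_in_tau_r.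
Qed.

(** In a groupoid the only idempotent is the identity: [l = tau l l = tau l (sigma l) = rho t]. This
    detour is what joins [mu m (rho n)] to [rho (app m n)]: no rule of [rw] rewrites either of
    them. *)
Lemma idempotent_involution_rho G A (t : tm G A) (l : cpath t t) :
  rweq (tau l l) l -> rweq (sigma l) l -> rweq l (rho t).
Proof.
  intros Hidem Hinv.
  apply rweq_trans with (tau l l); [now apply rweq_sym |].
  apply rweq_trans with (tau l (sigma l)).
  - apply rweq_tau; [apply rst_refl | now apply rweq_sym].
  - apply rweq_rw. exact (rw_tr hole l).
Qed.

Lemma mu_rho G A B (m : tm G (Arr A B)) (n : tm G A) :
  rweq (mu m (rho n)) (rho (app m n)).
Proof.
  apply idempotent_involution_rho.
  (* With [r := rho n] in the context [hmu m hole], right cancellation of a reflexive path is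
     exactly idempotence of [mu m (rho n)]. *)
  - apply rweq_rw. exact (rw_trr (hmu m hole) (rho n)).
  - eapply rweq_trans; apply rweq_rw;
      [apply rw_sm | apply rw_in_mu, rw_sr].
Qed.

Lemma nu_rho G A B (m : tm G (Arr A B)) (n : tm G A) :
  rweq (nu n (rho m)) (rho (app m n)).
Proof.
  apply idempotent_involution_rho.
  - apply rweq_rw. exact (rw_trr (hnu hole n) (rho m)).
  - eapply rweq_trans; apply rweq_rw;
      [apply rw_sn | apply rw_in_nu, rw_sr].
Qed.

Lemma xi_rho G A B (m : tm (A :: G) B) : rweq (xi (rho m)) (rho (lam m)).
Proof.
  apply idempotent_involution_rho.
  - apply rweq_rw. exact (rw_trr (hxi hole) (rho m)).
  - eapply rweq_trans; apply rweq_rw;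
      [apply rw_sx | apply rw_in_xi, rw_sr].
Qed.

Definition id_path G A (t u : tm G A) (e : t = u) : cpath t u :=
  match e in _ = u return cpath t u with eq_refl => rho t end.

Arguments id_path {G A t u} e.

(** Every generating rule preserves syntactic identity of end points. The induction runs over all
    contexts and types because [mu], [nu] and [xi] leave closed terms of type [Nat]. *)
Lemma generated_id_path G A (t u : tm G A) (p : cpath t u) :
  generated p -> exists e : t = u, rweq p (id_path e).
Proof.
  induction 1 as [G A t | G A t u p _ [e IH] | G A t u v p q _ [e IHp] _ [e' IHq]
                 | G A B m n n' p _ [e IH] | G A B m m' n p _ [e IH]
                 | G A B m m' p _ [e IH]].
  - exists eq_refl. apply rst_refl.
  (* Eliminating [e] turns [id_path e] into [rho t], so this case, like those below, asks only that
     its rule send reflexive paths to a reflexive one. *)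
  - destruct e. exists eq_refl. apply rweq_trans with (sigma (rho t)).
    + apply (rweq_map _ _ _ _ _ _ _ _ (@sigma _ _ t t)); [| exact IH].
      intros; now apply rw_in_sigma.
    + apply rweq_rw, rw_sr.
  - destruct e, e'. exists eq_refl. apply rweq_trans with (tau (rho t) (rho t)).
    + now apply rweq_tau.
    + apply rweq_rw. exact (rw_trr hole (rho t)).
  - destruct e. exists eq_refl. apply rweq_trans with (mu m (rho n)).
    + apply (rweq_map _ _ _ _ _ _ _ _ (@mu _ _ _ m n n)); [| exact IH].
      intros; now apply rw_in_mu.
    + apply mu_rho.
  - destruct e. exists eq_refl. apply rweq_trans with (nu n (rho m)).
    + apply (rweq_map _ _ _ _ _ _ _ _ (@nu _ _ _ m m n)); [| exact IH].
      intros; now apply rw_in_nu.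
    + apply nu_rho.
  - destruct e. exists eq_refl. apply rweq_trans with (xi (rho m)).
    + apply (rweq_map _ _ _ _ _ _ _ _ (@xi _ _ _ m m)); [| exact IH].
      intros; now apply rw_in_xi.
    + apply xi_rho.
Qed.

Lemma generated_rweq G A (t u : tm G A) (p q : cpath t u) :
  generated p -> generated q -> rweq p q.
Proof.
  intros Hp Hq.
  destruct (generated_id_path _ _ _ _ _ Hp) as [e He].
  destruct (generated_id_path _ _ _ _ _ Hq) as [e' He'].
  (* The identities come from two separate derivations; once they agree, both paths equal the same
     [id_path e]. *)
  rewrite (tm_uip _ _ _ _ e' e) in He'.
  apply rweq_trans with (id_path e); [exact He | now apply rweq_sym].
Qed.

Theorem theorem5p14 : is_set nat_path_eq.
Proof.
  intros x y [p Hp] [q Hq]. now apply generated_rweq.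
Qed.
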